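(* Let $\mathcal{A}$ be a $(\Gamma,\lambda)$-commutative algebra, $M$ a graded $\mathcal{A}$-module and $\varsigma\in\mathfrak{S}(\lambda)$. Let $\underline{\mathcal{A}}=I_\varsigma(\mathcal{A})$ and $\underline{M}=\widehat{I}_\varsigma(M)$. Then the map $$\eta_\varsigma:\ \mathcal{E}nd_{\mathcal{A}}(M)\longrightarrow \mathcal{E}nd_{\underline{\mathcal{A}}}(\underline{M}),$$ defined on homogeneous $f$ by $\eta_\varsigma(f)(m)=\varsigma(\tilde f,\tilde m)\,f(m)$ for all homogeneous $m\in M$ (and extended additively), is an isomorphism of $\mathcal{A}^0$-modules, and $$\eta_\varsigma(f\circ g)=\varsigma(\tilde f,\tilde g)^{-1}\,\eta_\varsigma(f)\circ\eta_\varsigma(g)$$ for any pair of homogeneous endomorphisms $f,g\in\mathcal{E}nd_{\mathcal{A}}(M)$.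
   Context: $\mathbb{K}$ is a field of characteristic zero and $\Gamma$ is a finitely generated abelian group (written additively). A commutation factor is a map $\lambda:\Gamma\times\Gamma\to\mathbb{K}^\times$ that is biadditive ($\lambda(x+y,z)=\lambda(x,z)\lambda(y,z)$, $\lambda(z,x+y)=\lambda(z,x)\lambda(z,y)$) and satisfies $\lambda(x,y)\lambda(y,x)=1$. A $(\Gamma,\lambda)$-commutative algebra is an associative unital $\mathbb{K}$-algebra $\mathcal{A}=\bigoplus_{\gamma\in\Gamma}\mathcal{A}^\gamma$ with $\mathcal{A}^\alpha\mathcal{A}^\beta\subset\mathcal{A}^{\alpha+\beta}$ and $ab=\lambda(\tilde a,\tilde b)\,ba$ for homogeneous $a,b$; $\tilde a$ denotes the degree of $a$. Parity: $\lambda(x,x)=\pm1$; $\phi_\lambda:\Gamma\to\mathbb{Z}_2$ is the group morphism with $\lambda(x,x)=(-1)^{\phi_\lambda(x)}$. $\mathfrak{S}(\lambda)$ is the set of NS-multipliers, i.e. biadditive maps $\varsigma:\Gamma\times\Gamma\to\mathbb{K}^\times$ such that $\lambda(x,y)\varsigma(x,y)\varsigma(y,x)^{-1}=(-1)^{\phi_\lambda(x)\phi_\lambda(y)}$ for all $x,y\in\Gamma$. For $\varsigma\in\mathfrak{S}(\lambda)$, $\underline{\mathcal{A}}=I_\varsigma(\mathcal{A})$ is the graded vector space $\mathcal{A}$ with product $a\star b=\varsigma(\tilde a,\tilde b)\,ab$ on homogeneous elements; it is supercommutative for the parity, and $\underline{\mathcal{A}}^0=\mathcal{A}^0$ as algebras.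 A graded $\mathcal{A}$-module is a $\Gamma$-graded vector space $M=\bigoplus_\gamma M^\gamma$ with left and right $\mathcal{A}$-module structures compatible with the grading and such that $m a=\lambda(\tilde m,\tilde a)\,a m$ for homogeneous $a,m$. $\underline{M}=\widehat{I}_\varsigma(M)$ is the graded vector space $M$ with the graded $\underline{\mathcal{A}}$-module structure $a\star m=\varsigma(\tilde a,\tilde m)\,am$ (and the corresponding right structure $m\star a=(-1)^{\phi_\lambda(\tilde m)\phi_\lambda(\tilde a)}a\star m$). $\mathcal{E}nd_{\mathcal{A}}(M)=\bigoplus_{\gamma\in\Gamma}\mathcal{E}nd^\gamma_{\mathcal{A}}(M)$, where $\mathcal{E}nd^\gamma_{\mathcal{A}}(M)$ is the set of right $\mathcal{A}$-linear maps $f:M\to M$ with $f(M^\alpha)\subset M^{\alpha+\gamma}$ for all $\alpha$; such an $f$ is homogeneous of degree $\tilde f=\gamma$. Its $\mathcal{A}$-module structure is given by $(af)(m)=a\cdot f(m)$. The same definitions apply to $\underline{\mathcal{A}}$ and $\underline{M}$. *)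

(* Defs.v *)
From HB Require Import structures.
From mathcomp Require Import all_boot all_order all_algebra.
From mathcomp Require Import mathcomp_extra boolp classical_sets functions.
From mathcomp Require Import cardinality fsbigop.
From mathcomp Require Import ring.

Set Implicit Arguments.
Unset Strict Implicit.
Unset Printing Implicit Defensive.

Import GRing.Theory.

Local Open Scope classical_set_scope.
Local Open Scope ring_scope.

Definition finitely_generated (G : zmodType) : Prop :=
  exists s : seq G, forall x, exists c : G -> int, x = \sum_(g <- s) g *~ c g.

Section CommutationFactors.
Variables (G : zmodType) (K : fieldType).

(* Maps G x G -> K^* are encoded as K-valued maps that never vanish. *)
Definition biadditive (f : G -> G -> K) : Prop :=
  [/\ forall x y, f x y != 0,
      forall x y z, f (x + y) z = f x z * f y z
    & forall x y z, f z (x + y) = f z x * f z y].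

Record comm_factor := CommFactor {
  cf_fun :> G -> G -> K;
  cf_biadd : biadditive cf_fun;
  cf_inv : forall x y, cf_fun x y * cf_fun y x = 1 }.

(* Z/2 is represented by (bool, (+)); parityP and parityD say that this is the
   group morphism with lam x x = (-1) ^+ parity lam x. *)
Definition parity (lam : G -> G -> K) (x : G) : bool := lam x x != 1.

Lemma parityP (lam : comm_factor) x : lam x x = (-1) ^+ parity lam x.
Proof.
rewrite /parity; case: eqP => [->//|/eqP ne1] /=.
have /eqP := cf_inv lam x x; rewrite -expr2 sqrf_eq1 (negPf ne1) /=.
by move/eqP->; rewrite expr1.
Qed.

Lemma parityD (lam : comm_factor) x y :
  parity lam (x + y) = parity lam x (+) parity lam y.
Proof.
have [_ Dl Dr] := cf_biadd lam.
have Dxy : lam (x + y) (x + y) = lam x x * lam y y.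
  by rewrite Dl !Dr -mulrA (mulrA (lam x y)) (cf_inv lam x y) mul1r.
rewrite /parity Dxy.
have sq1 z : lam z z = 1 \/ lam z z = -1.
  have /eqP := cf_inv lam z z; rewrite -expr2 sqrf_eq1.
  by case/orP => /eqP ->; [left | right].
case: (sq1 x) (sq1 y) => -> [] ->.
- by rewrite mulr1 eqxx.
- by rewrite mul1r eqxx.
- by rewrite mulr1 eqxx addbF.
- by rewrite mulrNN mulr1 eqxx addbb.
Qed.

(* super lam is (-1)^(parity x * parity y), so that I_s(A) below is again an
   instance of gcalg, for the factor super lam. *)
Definition super_fun (lam : G -> G -> K) (x y : G) : K :=
  (-1) ^+ (parity lam x * parity lam y).

Lemma super_biadd (lam : comm_factor) : biadditive (super_fun lam).
Proof.
split=> [x y|x y z|x y z]; first by rewrite /super_fun signr_eq0.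
  rewrite /super_fun parityD.
  by case: (parity lam x) (parity lam y) (parity lam z) => [] [] [];
     rewrite /= ?muln0 ?mul0n ?muln1 ?mulr1 ?mul1r ?expr1 ?expr0 ?mulrNN ?mulr1.
rewrite /super_fun parityD.
by case: (parity lam x) (parity lam y) (parity lam z) => [] [] [];
   rewrite /= ?muln0 ?mul0n ?muln1 ?mulr1 ?mul1r ?expr1 ?expr0 ?mulrNN ?mulr1.
Qed.

Lemma super_inv (lam : comm_factor) x y :
  super_fun lam x y * super_fun lam y x = 1.
Proof. by rewrite /super_fun mulnC -expr2 sqrr_sign. Qed.

Definition super (lam : comm_factor) : comm_factor :=
  CommFactor (super_biadd lam) (super_inv lam).

Record NS_multiplier (lam : comm_factor) := Multiplier {
  ms_fun :> G -> G -> K;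
  ms_biadd : biadditive ms_fun;
  ms_super : forall x y,
    lam x y * ms_fun x y * (ms_fun y x)^-1
      = (-1) ^+ (parity lam x * parity lam y) }.

Lemma biadd0l f x : biadditive f -> f 0 x = 1.
Proof.
case=> f0 Dl _; have := Dl 0 0 x; rewrite addr0 => /eqP.
by rewrite -[X in X == _]mul1r eq_sym (inj_eq (mulIf (f0 _ _))) => /eqP.
Qed.

Lemma biadd0r f x : biadditive f -> f x 0 = 1.
Proof.
case=> f0 _ Dr; have := Dr 0 0 x; rewrite addr0 => /eqP.
by rewrite -[X in X == _]mul1r eq_sym (inj_eq (mulIf (f0 _ _))) => /eqP.
Qed.

End CommutationFactors.

Section Gradings.
Variables (G : zmodType) (K : fieldType).

(* A decomposition V = \bigoplus_g V^g : subspaces V^g such that every vector is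
   a finite sum of elements of distinct V^g, and such that the V^g are
   independent. *)
Record grading (V : lmodType K) := Grading {
  gr :> G -> set V;
  gr0 : forall g, gr g 0;
  grP : forall g (a : K) u v, gr g u -> gr g v -> gr g (a *: u + v);
  gr_span : forall v, exists (s : seq G) (c : G -> V),
    [/\ uniq s, forall g, gr g (c g) & v = \sum_(g <- s) c g];
  gr_free : forall (s : seq G) (c : G -> V), uniq s ->
    (forall g, gr g (c g)) -> \sum_(g <- s) c g = 0 ->
    forall g, g \in s -> c g = 0 }.

Section Theory.
Variables (V : lmodType K) (D : grading V).

Lemma grD g u v : D g u -> D g v -> D g (u + v).
Proof. by move=> Du Dv; rewrite -[u]scale1r; exact: grP. Qed.

Lemma grZ g a u : D g u -> D g (a *: u).
Proof. by move=> Du; rewrite -[_ *: _]addr0; apply: grP => //; exact: gr0. Qed.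

Lemma grB g u v : D g u -> D g v -> D g (u - v).
Proof. by move=> Du Dv; rewrite -scaleN1r; apply/grD/grZ. Qed.

Lemma gr_ind (P : V -> Prop) :
  (forall g v, D g v -> P v) -> (forall u v, P u -> P v -> P (u + v)) ->
  forall v, P v.
Proof.
move=> Ph PD v; have [s [c [_ Dc ->]]] := gr_span D v.
elim/big_ind: _ => // [|g _]; first exact: (Ph 0 _ (gr0 D 0)).
exact: Ph (Dc g).
Qed.

Definition is_decomp (v : V) (s : seq G) (c : G -> V) : Prop :=
  [/\ uniq s, forall g, D g (c g), forall g, g \notin s -> c g = 0
    & v = \sum_(g <- s) c g].

Lemma component_ex v : exists c : G -> V, exists s, is_decomp v s c.
Proof.
have [s [c [us Dc ->]]] := gr_span D v.
exists (fun g => if g \in s then c g else 0), s; split=> // [g|g /negPf->//|].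
  by case: ifP => // _; exact: gr0.
by rewrite !big_seq; apply: eq_bigr => g ->.
Qed.

(* component v g is the summand of v that lies in D g. *)
Definition component (v : V) : G -> V := projT1 (cid (component_ex v)).

Lemma component_decomp v : exists s, is_decomp v s (component v).
Proof. exact: (projT2 (cid (component_ex v))). Qed.

Lemma decomp_widen v s t c : is_decomp v s c -> uniq t -> {subset s <= t} ->
  is_decomp v t c.
Proof.
case=> us Dc c0 vE ut st; split=> // [g|].
  by move=> gt; apply: c0; apply: contra gt; exact: st.
rewrite vE [RHS](bigID (mem s)) /= [X in _ + X]big1 ?addr0; last by move=> g /c0.
rewrite -[RHS]big_filter; apply: perm_big; apply: uniq_perm => //.
  by rewrite filter_uniq.
move=> g; rewrite mem_filter /=.
by case: (boolP (g \in s)) => [/st->|].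
Qed.

Lemma decomp_uniq v s t c d : is_decomp v s c -> is_decomp v t d -> c = d.
Proof.
move=> Hc Hd; set r := undup (s ++ t).
have ur : uniq r by exact: undup_uniq.
have [] : is_decomp v r c.
  by apply: decomp_widen Hc _ _ => // g gs; rewrite mem_undup mem_cat gs.
move=> _ Dc c0 vc.
have [] : is_decomp v r d.
  by apply: decomp_widen Hd _ _ => // g gs; rewrite mem_undup mem_cat gs orbT.
move=> _ Dd d0 vd; apply/funext => g.
have [gr|gr] := boolP (g \in r); last by rewrite c0 ?d0.
apply/eqP; rewrite -subr_eq0; apply/eqP.
apply: (@gr_free _ D r (fun g => c g - d g)) => //.
  by move=> h; exact: grB.
by rewrite sumrB -vc -vd subrr.
Qed.

Lemma componentE v s c : is_decomp v s c -> component v = c.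
Proof. by have [t] := component_decomp v; exact: decomp_uniq. Qed.

Lemma component_in v g : D g (component v g).
Proof. by have [s []] := component_decomp v. Qed.

Lemma component_hom g v : D g v ->
  component v = fun h => if h == g then v else 0.
Proof.
move=> Dv; apply: (@componentE _ [:: g]); split=> //.
- by move=> h; case: eqP => [->//|_]; exact: gr0.
- by move=> h; rewrite inE => /negPf->.
- by rewrite big_seq1 eqxx.
Qed.

Lemma component_linear g : linear (component^~ g : V -> V).
Proof.
move=> a u v.
have [s Hu] := component_decomp u; have [t Hv] := component_decomp v.
set r := undup (s ++ t).
have ur : uniq r by exact: undup_uniq.
have [] : is_decomp u r (component u).
  by apply: decomp_widen Hu _ _ => // h hs; rewrite mem_undup mem_cat hs.
move=> _ Dc c0 vc.
have [] : is_decomp v r (component v).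
  by apply: decomp_widen Hv _ _ => // h hs; rewrite mem_undup mem_cat hs orbT.
move=> _ Dd d0 vd.
rewrite (@componentE (a *: u + v) r (fun h => a *: component u h + component v h)) //.
split=> // [h|h hr|]; first exact: grP.
  by rewrite c0 ?d0 // scaler0 addr0.
by rewrite big_split /= -scaler_sumr -vc -vd.
Qed.

Section Extension.
Variables (W : lmodType K) (h : G -> V -> W).

Definition gr_ext (v : V) : W := \sum_(g \in [set: G]) h g (component v g).

Hypothesis h_lin : forall g, linear (h g).

Let h0 g : h g 0 = 0.
Proof. by have := h_lin g (-1) 0 0; rewrite scaler0 addr0 scaleN1r addNr. Qed.

Lemma gr_extE v s : uniq s -> (forall g, g \notin s -> component v g = 0) ->
  gr_ext v = \sum_(g <- s) h g (component v g).
Proof.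
move=> us c0; rewrite /gr_ext (fsbigE s) //; last by move=> g _ /c0->.
by apply: eq_bigl => g; rewrite in_setT.
Qed.

Lemma gr_ext_hom g v : D g v -> gr_ext v = h g v.
Proof.
move=> Dv; rewrite (@gr_extE _ [:: g]) // (component_hom Dv).
  by rewrite big_seq1 eqxx.
by move=> k; rewrite inE => /negPf->.
Qed.

Lemma gr_ext_linear : linear gr_ext.
Proof.
move=> a u v.
have [s [us _ cu _]] := component_decomp u.
have [t [ut _ cv _]] := component_decomp v.
set r := undup (s ++ t).
have ur : uniq r by exact: undup_uniq.
have cu' g : g \notin r -> component u g = 0.
  by rewrite mem_undup mem_cat negb_or => /andP[/cu].
have cv' g : g \notin r -> component v g = 0.
  by rewrite mem_undup mem_cat negb_or => /andP[_ /cv].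
rewrite (gr_extE ur cu') (gr_extE ur cv') (@gr_extE _ r) //; last first.
  by move=> g gr; rewrite component_linear cu' ?cv' // scaler0 addr0.
rewrite scaler_sumr -big_split /=; apply: eq_bigr => g _.
by rewrite component_linear h_lin.
Qed.

End Extension.

End Theory.

Definition bilin (U V W : lmodType K) (B : U -> V -> W) : Prop :=
  (forall u, linear (B u)) /\ (forall v, linear (B^~ v)).

(* The bilinear map that is (u, v) |-> c(|u|, |v|) B(u, v) on homogeneous
   elements. *)
Definition twist (U V W : lmodType K) (DU : grading U) (DV : grading V)
    (c : G -> G -> K) (B : U -> V -> W) (u : U) (v : V) : W :=
  \sum_(a \in [set: G]) \sum_(b \in [set: G])
    c a b *: B (component DU u a) (component DV v b).

Section Twist.
Variables (U V W : lmodType K) (DU : grading U) (DV : grading V).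
Variables (c : G -> G -> K) (B : U -> V -> W).
Hypothesis Bb : bilin B.

Let inner_lin a u : linear (fun v => gr_ext DV (fun b w => c a b *: B u w) v).
Proof.
apply: gr_ext_linear => b k x y.
by rewrite (Bb.1 u) scalerDr !scalerA mulrC.
Qed.

Let outer_lin v a : linear (fun u => gr_ext DV (fun b w => c a b *: B u w) v).
Proof.
move=> k x y.
have Blin u b : linear (fun w => c a b *: B u w).
  by move=> l s t; rewrite (Bb.1 u) scalerDr !scalerA mulrC.
have [s [us _ cv _]] := component_decomp DV v.
rewrite !(@gr_extE _ DV _ _ _ _ s) // scaler_sumr -big_split /=.
by apply: eq_bigr => b _; rewrite (Bb.2 _ k) scalerDr !scalerA mulrC.
Qed.

Lemma twist_bilin : bilin (twist DU DV c B).
Proof.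
split=> [u|v]; last first.
  by move=> k x y; exact: (@gr_ext_linear _ DU _ _ (outer_lin v) k x y).
move=> k x y; have [s [us _ cu _]] := component_decomp DU u.
have E v : twist DU DV c B u v =
   \sum_(a <- s) gr_ext DV (fun b w => c a b *: B (component DU u a) w) v.
  exact: (gr_extE (outer_lin v) us cu).
rewrite !E scaler_sumr -big_split /=; apply: eq_bigr => a _.
exact: inner_lin.
Qed.

Lemma twist_hom a b u v : DU a u -> DV b v -> twist DU DV c B u v = c a b *: B u v.
Proof.
move=> Du Dv; rewrite (_ : twist _ _ _ _ _ _ =
  gr_ext DU (fun a u => gr_ext DV (fun b w => c a b *: B u w) v) u) //.
rewrite (gr_ext_hom (outer_lin v) Du) (@gr_ext_hom _ _ _ _ _ b) //.
by move=> b' k x y; rewrite (Bb.1 u) scalerDr !scalerA mulrC.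
Qed.

End Twist.

End Gradings.

Section Bilin.
Variables (K : fieldType) (U V W : lmodType K) (B : U -> V -> W).
Hypothesis Bb : bilin B.

Lemma bilinDl u u' v : B (u + u') v = B u v + B u' v.
Proof. by have := Bb.2 v 1 u u'; rewrite /= !scale1r. Qed.
Lemma bilinDr u v v' : B u (v + v') = B u v + B u v'.
Proof. by have := Bb.1 u 1 v v'; rewrite /= !scale1r. Qed.
Lemma bilin0l v : B 0 v = 0.
Proof. by have := Bb.2 v (-1) 0 0; rewrite /= scaler0 addr0 scaleN1r addNr. Qed.
Lemma bilin0r u : B u 0 = 0.
Proof. by have := Bb.1 u (-1) 0 0; rewrite /= scaler0 addr0 scaleN1r addNr. Qed.
Lemma bilinZl k u v : B (k *: u) v = k *: B u v.
Proof. by have := Bb.2 v k u 0; rewrite /= !addr0 bilin0l addr0. Qed.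
Lemma bilinZr k u v : B u (k *: v) = k *: B u v.
Proof. by have := Bb.1 u k v 0; rewrite /= !addr0 bilin0r addr0. Qed.
Lemma bilin_sumr (I : Type) (r : seq I) u (F : I -> V) :
  B u (\sum_(i <- r) F i) = \sum_(i <- r) B u (F i).
Proof. by elim/big_rec2: _ => [|i x y _ <-]; rewrite ?bilin0r ?bilinDr. Qed.
Lemma bilin_suml (I : Type) (r : seq I) v (F : I -> U) :
  B (\sum_(i <- r) F i) v = \sum_(i <- r) B (F i) v.
Proof. by elim/big_rec2: _ => [|i x y _ <-]; rewrite ?bilin0l ?bilinDl. Qed.

End Bilin.

Section Algebras.
Variables (G : zmodType) (K : fieldType).

(* (G, lam)-commutative algebras. The structure algType of the library is not
   used because it excludes the zero algebra. *)
Record gcalg (lam : comm_factor G K) := GCAlg {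
  ga_sort :> lmodType K;
  ga_mul : ga_sort -> ga_sort -> ga_sort;
  ga_one : ga_sort;
  ga_gr : grading G ga_sort;
  ga_bilin : bilin ga_mul;
  ga_mulA : associative ga_mul;
  ga_mul1l : left_id ga_one ga_mul;
  ga_mul1r : right_id ga_one ga_mul;
  ga_grM : forall a b x y,
    ga_gr a x -> ga_gr b y -> ga_gr (a + b) (ga_mul x y);
  ga_comm : forall a b x y,
    ga_gr a x -> ga_gr b y -> ga_mul x y = lam a b *: ga_mul y x }.

Lemma ga_one0 lam (A : gcalg lam) : ga_gr A 0 (ga_one A).
Proof.
set c := component (ga_gr A) (ga_one A).
have Dc g : ga_gr A g (c g) by exact: component_in.
have c1 : forall x, ga_mul (c 0) x = x.
  apply: (gr_ind (D := ga_gr A)) => [g x Dx|x y xE yE]; last first.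
    by rewrite (bilinDr (ga_bilin A)) xE yE.
  have [s [us _ c0 E]] := component_decomp (ga_gr A) (ga_one A).
  have /(congr1 (fun f => f g)) : component (ga_gr A) x
     = fun h => ga_mul (c (h - g)) x.
    apply: (@componentE _ _ _ _ _ [seq h + g | h <- s]); split.
    - by rewrite map_inj_uniq //; exact: addIr.
    - by move=> h; rewrite -{1}(subrK g h); exact: ga_grM.
    - move=> h hs; rewrite /c c0 ?(bilin0l (ga_bilin A)) //.
      by apply: contra hs => /(map_f (fun h => h + g)); rewrite subrK.
    - rewrite big_map -[LHS](ga_mul1l x) [in LHS]E.
      rewrite (bilin_suml (ga_bilin A)); apply: eq_bigr => h _.
      by rewrite addrK.
  by rewrite (component_hom Dx) eqxx subrr.
by rewrite -(c1 (ga_one A)) ga_mul1r.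
Qed.

Section TwistAlg.
Variables (lam : comm_factor G K) (s : NS_multiplier lam) (A : gcalg lam).

Definition star : A -> A -> A := twist (ga_gr A) (ga_gr A) s (@ga_mul _ A).

Let starE a b x y : ga_gr A a x -> ga_gr A b y ->
  star x y = s a b *: ga_mul x y.
Proof. by apply: twist_hom; exact: ga_bilin. Qed.

Lemma star_bilin : bilin star.
Proof. by apply: twist_bilin; exact: ga_bilin. Qed.

Lemma star_gr a b x y :
  ga_gr A a x -> ga_gr A b y -> ga_gr A (a + b) (star x y).
Proof. by move=> Dx Dy; rewrite (starE Dx Dy); apply/grZ/ga_grM. Qed.

Lemma starA : associative star.
Proof.
have [s0 sl sr] := ms_biadd s.
move=> x y z; have bs := star_bilin; have bm := ga_bilin A.
elim/(gr_ind (D := ga_gr A)): x => [a x Dx|x x' xE xE']; last first.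
  by rewrite !(bilinDl bs) xE xE'.
elim/(gr_ind (D := ga_gr A)): y => [b y Dy|y y' yE yE']; last first.
  by rewrite (bilinDl bs) !(bilinDr bs) (bilinDl bs) yE yE'.
elim/(gr_ind (D := ga_gr A)): z => [c z Dz|z z' zE zE']; last first.
  by rewrite !(bilinDr bs) zE zE'.
rewrite (starE Dx (star_gr Dy Dz)) (starE (star_gr Dx Dy) Dz).
rewrite (starE Dy Dz) (starE Dx Dy) (bilinZr bm) (bilinZl bm) ga_mulA.
by rewrite !scalerA sl sr; congr (_ *: _); rewrite -!mulrA mulrC -!mulrA mulrC -!mulrA.
Qed.

Lemma star1l : left_id (ga_one A) star.
Proof.
apply: (gr_ind (D := ga_gr A)) => [a x Dx|x y xE yE].
  by rewrite (starE (ga_one0 A) Dx) (biadd0l _ (ms_biadd s)) scale1r ga_mul1l.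
by rewrite (bilinDr star_bilin) xE yE.
Qed.

Lemma star1r : right_id (ga_one A) star.
Proof.
apply: (gr_ind (D := ga_gr A)) => [a x Dx|x y xE yE].
  by rewrite (starE Dx (ga_one0 A)) (biadd0r _ (ms_biadd s)) scale1r ga_mul1r.
by rewrite (bilinDl star_bilin) xE yE.
Qed.

Lemma ms_swap a b : lam a b * s a b = super lam a b * s b a.
Proof.
have [s0 _ _] := ms_biadd s.
by rewrite /super /super_fun /= -(ms_super s a b) mulfVK.
Qed.

Lemma star_comm a b x y : ga_gr A a x -> ga_gr A b y ->
  star x y = super lam a b *: star y x.
Proof.
move=> Dx Dy; rewrite (starE Dx Dy) (starE Dy Dx) (ga_comm Dx Dy) !scalerA.
by rewrite mulrC ms_swap.
Qed.

(* I_s(A), on the same graded vector space; its unit is unchanged because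
   s 0 x = s x 0 = 1. *)
Definition twist_alg : gcalg (super lam) :=
  @GCAlg (super lam) A star (ga_one A) (ga_gr A) star_bilin starA star1l star1r
    star_gr star_comm.

Lemma star0 x y : ga_gr A 0 x -> ga_gr A 0 y -> star x y = ga_mul x y.
Proof.
by move=> Dx Dy; rewrite (starE Dx Dy) (biadd0l _ (ms_biadd s)) scale1r.
Qed.

End TwistAlg.

(* Since the two actions determine each other, the bimodule identity
   (x m) y = x (m y) is a consequence of the axioms; see lract. *)
Record gmod (lam : comm_factor G K) (A : gcalg lam) := GMod {
  gm_sort :> lmodType K;
  gm_gr : grading G gm_sort;
  lact : A -> gm_sort -> gm_sort;
  ract : gm_sort -> A -> gm_sort;
  lact_bilin : bilin lact;
  ract_bilin : bilin ract;
  lactA : forall x y m, lact x (lact y m) = lact (ga_mul x y) m;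
  lact1 : forall m, lact (ga_one A) m = m;
  ractA : forall m x y, ract (ract m x) y = ract m (ga_mul x y);
  ract1 : forall m, ract m (ga_one A) = m;
  lact_gr : forall a b x m,
    ga_gr A a x -> gm_gr b m -> gm_gr (a + b) (lact x m);
  ract_gr : forall a b x m,
    ga_gr A a x -> gm_gr b m -> gm_gr (b + a) (ract m x);
  gm_comm : forall a b x m,
    ga_gr A a x -> gm_gr b m -> ract m x = lam b a *: lact x m }.

Lemma lract lam (A : gcalg lam) (M : gmod A) x (m : M) y :
  lact x (ract m y) = ract (lact x m) y.
Proof.
have bl := lact_bilin M; have br := ract_bilin M.
elim/(gr_ind (D := ga_gr A)): x => [a x Dx|x x' xE xE']; last first.
  by rewrite !(bilinDl bl) (bilinDl br) xE xE'.
elim/(gr_ind (D := ga_gr A)): y => [b y Dy|y y' yE yE']; last first.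
  by rewrite !(bilinDr br) (bilinDr bl) yE yE'.
elim/(gr_ind (D := gm_gr M)): m => [c m Dm|m m' mE mE']; last first.
  by rewrite (bilinDl br) !(bilinDr bl) (bilinDl br) mE mE'.
rewrite (gm_comm Dy Dm) (gm_comm Dy (lact_gr Dx Dm)) (bilinZr bl) !lactA.
rewrite (ga_comm Dx Dy) (bilinZl bl) scalerA; congr (_ *: _).
by have [_ l _] := cf_biadd lam; rewrite l mulrC.
Qed.

Section TwistMod.
Variables (lam : comm_factor G K) (s : NS_multiplier lam).
Variables (A : gcalg lam) (M : gmod A).

Definition star_lact : A -> M -> M := twist (ga_gr A) (gm_gr M) s (@lact _ _ M).

(* m * x = (-1)^(|m||x|) x * m = (-1)^(|m||x|) s(|x|, |m|) x m *)
Definition star_ract : M -> A -> M :=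
  twist (gm_gr M) (ga_gr A) (fun b a => super lam b a * s a b)
    (fun m x => lact x m).

Let flip_bilin : bilin (fun (m : M) (x : A) => lact x m).
Proof. by have [l r] := lact_bilin M; split. Qed.

Lemma star_lactE a b x m : ga_gr A a x -> gm_gr M b m ->
  star_lact x m = s a b *: lact x m.
Proof. by apply: twist_hom; exact: lact_bilin. Qed.

Lemma star_ractE a b x m : ga_gr A a x -> gm_gr M b m ->
  star_ract m x = (super lam b a * s a b) *: lact x m.
Proof. by move=> Dx Dm; rewrite /star_ract (twist_hom _ flip_bilin Dm Dx). Qed.

Lemma star_lact_bilin : bilin star_lact.
Proof. by apply: twist_bilin; exact: lact_bilin. Qed.

Lemma star_ract_bilin : bilin star_ract.
Proof. exact: twist_bilin. Qed.

Lemma star_lact_gr a b x m :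
  ga_gr A a x -> gm_gr M b m -> gm_gr M (a + b) (star_lact x m).
Proof. by move=> Dx Dm; rewrite (star_lactE Dx Dm); apply/grZ/lact_gr. Qed.

Lemma star_ract_gr a b x m :
  ga_gr A a x -> gm_gr M b m -> gm_gr M (b + a) (star_ract m x).
Proof.
by move=> Dx Dm; rewrite (star_ractE Dx Dm) addrC; apply/grZ/lact_gr.
Qed.

Lemma star_lactA x y m :
  star_lact x (star_lact y m) = star_lact (star s x y) m.
Proof.
have [s0 sl sr] := ms_biadd s.
have bl := star_lact_bilin; have bs := star_bilin s A.
elim/(gr_ind (D := ga_gr A)): x => [a x Dx|x x' xE xE']; last first.
  by rewrite (bilinDl bs) !(bilinDl bl) xE xE'.
elim/(gr_ind (D := ga_gr A)): y => [b y Dy|y y' yE yE']; last first.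
  by rewrite (bilinDr bs) !(bilinDl bl) (bilinDr bl) yE yE'.
elim/(gr_ind (D := gm_gr M)): m => [c m Dm|m m' mE mE']; last first.
  by rewrite !(bilinDr bl) mE mE'.
rewrite (star_lactE Dx (star_lact_gr Dy Dm)).
rewrite (star_lactE (star_gr s Dx Dy) Dm) (star_lactE Dy Dm).
rewrite [star s x y](twist_hom _ (ga_bilin A) Dx Dy).
rewrite (bilinZl (lact_bilin M)) (bilinZr (lact_bilin M)) lactA.
rewrite !scalerA sl sr; congr (_ *: _).
by rewrite -!mulrA mulrC -!mulrA mulrC -!mulrA.
Qed.

Lemma star_lact1 m : star_lact (ga_one A) m = m.
Proof.
elim/(gr_ind (D := gm_gr M)): m => [a m Dm|m n mE nE].
  by rewrite (star_lactE (ga_one0 A) Dm) (biadd0l _ (ms_biadd s)) scale1r lact1.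
by rewrite (bilinDr star_lact_bilin) mE nE.
Qed.

Lemma star_ract1 m : star_ract m (ga_one A) = m.
Proof.
elim/(gr_ind (D := gm_gr M)): m => [a m Dm|m n mE nE].
  rewrite (star_ractE (ga_one0 A) Dm) (biadd0l _ (ms_biadd s)).
  by rewrite (biadd0r _ (cf_biadd (super lam))) mul1r scale1r lact1.
by rewrite (bilinDl star_ract_bilin) mE nE.
Qed.

Lemma star_ractA m x y :
  star_ract (star_ract m x) y = star_ract m (star s x y).
Proof.
have [s0 sl sr] := ms_biadd s.
have [_ tl tr] := cf_biadd (super lam).
have bl := star_ract_bilin; have bs := star_bilin s A.
elim/(gr_ind (D := ga_gr A)): x => [a x Dx|x x' xE xE']; last first.
  by rewrite (bilinDl bs) !(bilinDr bl) (bilinDl bl) xE xE'.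
elim/(gr_ind (D := ga_gr A)): y => [b y Dy|y y' yE yE']; last first.
  by rewrite (bilinDr bs) !(bilinDr bl) yE yE'.
elim/(gr_ind (D := gm_gr M)): m => [c m Dm|m m' mE mE']; last first.
  by rewrite !(bilinDl bl) mE mE'.
rewrite (star_ractE Dy (star_ract_gr Dx Dm)).
rewrite (star_ractE (star_gr s Dx Dy) Dm) (star_ractE Dx Dm).
rewrite [star s x y](twist_hom _ (ga_bilin A) Dx Dy).
rewrite (ga_comm Dx Dy) !(bilinZl (lact_bilin M)) (bilinZr (lact_bilin M)) lactA.
rewrite !scalerA; congr (_ *: _).
rewrite sl sr tl tr.
have E := ms_swap s a b.
transitivity (super lam c a * super lam c b * s a c * s b c
              * (super lam a b * s b a)).
  by ring.
by rewrite -E; ring.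
Qed.

Lemma star_gm_comm a b x m : ga_gr A a x -> gm_gr M b m ->
  star_ract m x = super lam b a *: star_lact x m.
Proof.
by move=> Dx Dm; rewrite (star_ractE Dx Dm) (star_lactE Dx Dm) scalerA.
Qed.

Definition twist_mod : gmod (twist_alg s A) :=
  @GMod (super lam) (twist_alg s A) M (gm_gr M) star_lact star_ract
    star_lact_bilin star_ract_bilin star_lactA star_lact1 star_ractA star_ract1
    star_lact_gr star_ract_gr star_gm_comm.

End TwistMod.
End Algebras.

Section Endomorphisms.
Variables (G : zmodType) (K : fieldType) (lam : comm_factor G K).
Variables (A : gcalg lam) (M : gmod A).

(* K-linearity is a consequence, since A is unital. *)
Definition right_linear (f : M -> M) : Prop :=
  (forall m n, f (m + n) = f m + f n) /\
  (forall m x, f (ract m x) = ract (f m) x).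

Definition deg_shift (g : G) (f : M -> M) : Prop :=
  forall a m, gm_gr M a m -> gm_gr M (a + g) (f m).

(* Finite sums of homogeneous right A-linear maps: when G is infinite these need
   not be all the right A-linear maps. *)
Definition end_pred : {pred M -> M} := fun f =>
  `[< exists (r : seq G) (F : G -> M -> M),
        (forall g, right_linear (F g) /\ deg_shift g (F g)) /\
        f = \sum_(g <- r) F g >].

Lemma right_linear0 : right_linear (0 : M -> M).
Proof.
have E m : (0 : M -> M) m = 0 :> M by [].
by split=> [m n|m x]; rewrite !E ?addr0 // (bilin0l (ract_bilin M)).
Qed.

Lemma right_linearP k (f g : M -> M) :
  right_linear f -> right_linear g -> right_linear (k *: f + g).
Proof.
case=> fD fR [gD gR]; have E m : (k *: f + g) m = k *: f m + g m :> M by [].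
split=> [m n|m x].
  by rewrite !E fD gD scalerDr addrACA.
by rewrite !E (bilinDl (ract_bilin M)) (bilinZl (ract_bilin M)) fR gR.
Qed.

Lemma deg_shift0 g : deg_shift g 0.
Proof. by move=> a m _; exact: gr0. Qed.

Lemma deg_shiftP g k (f h : M -> M) :
  deg_shift g f -> deg_shift g h -> deg_shift g (k *: f + h).
Proof. by move=> Df Dh a m Dm; apply: grP; [exact: Df | exact: Dh]. Qed.

Lemma end_predP f : f \in end_pred -> exists (r : seq G) (F : G -> M -> M),
  [/\ uniq r, forall g, right_linear (F g) /\ deg_shift g (F g)
    & f = \sum_(g <- r) F g].
Proof.
move=> /asboolP [r [F [HF ->]]].
exists (undup r), (fun g => F g *+ count_mem g r); split.
- exact: undup_uniq.
- move=> g; elim: (count_mem g r) => [|n [IHl IHd]].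
    by rewrite mulr0n; split; [exact: right_linear0 | exact: deg_shift0].
  have [Fl Fd] := HF g; rewrite mulrS -[X in X + _]scale1r.
  by split; [exact: right_linearP | exact: deg_shiftP].
- by rewrite -big_undup_iterop_count; apply: eq_bigr => g _;
     rewrite Monoid.iteropE iter_addr_0.
Qed.

Lemma end_pred_hom g f : right_linear f -> deg_shift g f -> f \in end_pred.
Proof.
move=> fl fd; apply/asboolP; exists [:: g], (fun h => if h == g then f else 0).
split; last by rewrite big_seq1 eqxx.
by move=> h; case: eqP => [->|_]; split=> //; [exact: right_linear0 | exact: deg_shift0].
Qed.

Lemma end_pred_closed : GRing.submod_closed end_pred.
Proof.
split.
  by apply: (@end_pred_hom 0); [exact: right_linear0 | exact: deg_shift0].
move=> k f g /end_predP [r [F [ur HF ->]]] /end_predP [t [H [ut HH ->]]].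
apply/asboolP; exists (undup (r ++ t)),
  (fun g => k *: (if g \in r then F g else 0) + (if g \in t then H g else 0)).
split=> [a|].
  have [Fl Fd] := HF a; have [Hl Hd] := HH a.
  by split; [apply: right_linearP | apply: deg_shiftP];
     case: ifP => // _; do [exact: right_linear0 | exact: deg_shift0].
have widen (L : G -> M -> M) (q : seq G) : uniq q -> {subset q <= r ++ t} ->
    \sum_(g <- q) L g = \sum_(g <- undup (r ++ t)) (if g \in q then L g else 0).
  move=> uq qs; rewrite -big_mkcond -[RHS]big_filter; apply: perm_big.
  apply: uniq_perm => //; first by rewrite filter_uniq ?undup_uniq.
  move=> x; rewrite mem_filter mem_undup.
  by case: (boolP (x \in q)) => [/qs->|].
rewrite big_split /= -scaler_sumr -!widen // => x xr; rewrite mem_cat xr ?orbT //.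
Qed.

HB.instance Definition _ :=
  GRing.isSubmodClosed.Build K (M -> M) end_pred end_pred_closed.

Record gEnd := GEnd { gEnd_fun :> M -> M; gEnd_in : gEnd_fun \in end_pred }.

HB.instance Definition _ := [isSub of gEnd for gEnd_fun].
HB.instance Definition _ := [Choice of gEnd by <:].
HB.instance Definition _ := [SubChoice_isSubLmodule of gEnd by <:].

Lemma gEndP (f h : gEnd) : f =1 h -> f = h.
Proof. by move=> fh; apply: val_inj; apply/funext. Qed.

Lemma gEndD (f h : gEnd) m : (f + h) m = f m + h m. Proof. by []. Qed.
Lemma gEndZ k (f : gEnd) m : (k *: f) m = k *: f m. Proof. by []. Qed.
Lemma gEnd_sum (I : Type) (r : seq I) (F : I -> gEnd) m :
  (\sum_(i <- r) F i) m = \sum_(i <- r) F i m.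
Proof. by elim/big_rec2: _ => // i x y _ <-. Qed.

Lemma gEnd_right_linear (f : gEnd) : right_linear f.
Proof.
case: f => f /= /asboolP [r [F [HF ->]]].
elim/big_ind: _ => [|u v ul vl|g _]; first exact: right_linear0.
  by rewrite -[u]scale1r; exact: right_linearP.
exact: (HF g).1.
Qed.

Definition end_gr (g : G) : set gEnd := [set f | deg_shift g f].

Lemma end_gr_span (f : gEnd) : exists (r : seq G) (c : G -> gEnd),
  [/\ uniq r, forall g, end_gr g (c g) & f = \sum_(g <- r) c g].
Proof.
have [r [F [ur HF fE]]] := end_predP (gEnd_in f).
exists r, (fun g => GEnd (end_pred_hom (HF g).1 (HF g).2)); split=> //.
  by move=> g; exact: (HF g).2.
apply: gEndP => m; rewrite gEnd_sum fE.
by elim/big_rec2: _ => // i x y _ <-.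
Qed.

Lemma end_gr_free (r : seq G) (c : G -> gEnd) : uniq r ->
  (forall g, end_gr g (c g)) -> \sum_(g <- r) c g = 0 ->
  forall g, g \in r -> c g = 0.
Proof.
move=> ur Dc c0 g gr; apply: gEndP; apply: (gr_ind (D := gm_gr M)); last first.
  move=> u v uE vE; rewrite (gEnd_right_linear _).1 uE vE.
  by rewrite -[LHS]/(0 + 0 : M) addr0.
move=> a m Dm.
have := @gr_free _ _ _ (gm_gr M) [seq a + h | h <- r] (fun h => c (h - a) m).
rewrite map_inj_uniq; last exact: addrI.
move=> /(_ ur) H; have := H _ _ (a + g) _; rewrite addrAC subrr add0r; apply.
- by move=> h; have := Dc (h - a) a m Dm; rewrite addrC subrK.
- rewrite big_map; under eq_bigr do rewrite addrAC subrr add0r.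
  by rewrite -gEnd_sum c0.
- exact: map_f.
Qed.

Lemma end_gr0 g : end_gr g 0.
Proof. exact: deg_shift0. Qed.

Lemma end_grP g k (f h : gEnd) :
  end_gr g f -> end_gr g h -> end_gr g (k *: f + h).
Proof. exact: deg_shiftP. Qed.

Definition gEnd_grading : grading G gEnd :=
  Grading end_gr0 end_grP end_gr_span end_gr_free.

Lemma right_linear_act x (f : gEnd) : right_linear (fun m => lact x (f m)).
Proof.
have bl := lact_bilin M; have br := ract_bilin M.
have [fD fR] := gEnd_right_linear f.
split=> [m n|m z]; first by rewrite fD (bilinDr bl).
by rewrite fR lract.
Qed.

Lemma end_act_in x (f : gEnd) : (fun m => lact x (f m)) \in end_pred.
Proof.
have bl := lact_bilin M.
elim/(gr_ind (D := ga_gr A)): x => [a x Dx|x y xE yE]; last first.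
  rewrite (_ : (fun _ => _) =
    1 *: (fun m => lact x (f m)) + (fun m => lact y (f m))).
    exact: (end_pred_closed.2 1).
  by apply/funext => m; rewrite (bilinDl bl) -[lact x _]scale1r.
elim/(gr_ind (D := gEnd_grading)): f => [g f Df|f h fE hE]; last first.
  rewrite (_ : (fun _ => _) =
    1 *: (fun m => lact x (f m)) + (fun m => lact x (h m))).
    exact: (end_pred_closed.2 1).
  by apply/funext => m; rewrite gEndD (bilinDr bl) -[lact x (f m)]scale1r.
apply: (@end_pred_hom (a + g)); first exact: right_linear_act.
by move=> b m Dm; rewrite addrCA; apply: lact_gr => //; exact: Df.
Qed.

Definition end_act (x : A) (f : gEnd) : gEnd := GEnd (end_act_in x f).

Lemma end_act_bilin : bilin end_act.
Proof.
have bl := lact_bilin M.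
split=> [x k f h|f k x y]; apply: gEndP => m.
  exact: (bl.1 x k (f m) (h m)).
exact: (bl.2 (f m) k x y).
Qed.

Lemma end_actA x y f : end_act x (end_act y f) = end_act (ga_mul x y) f.
Proof. by apply: gEndP => m /=; rewrite lactA. Qed.

Lemma end_act1 f : end_act (ga_one A) f = f.
Proof. by apply: gEndP => m /=; rewrite lact1. Qed.

Lemma end_comp_in (f h : gEnd) : f \o h \in end_pred.
Proof.
have addf (u v : M -> M) : u \in end_pred -> v \in end_pred -> u + v \in end_pred.
  by move=> uE vE; rewrite -[u]scale1r; exact: end_pred_closed.2.
elim/(gr_ind (D := gEnd_grading)): f => [a f Df|f f' fE fE']; last first.
  exact: (addf _ _ fE fE').
elim/(gr_ind (D := gEnd_grading)): h => [b h Dh|h h' hE hE']; last first.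
  rewrite (_ : _ \o _ = (f \o h) + (f \o h')); first exact: addf.
  by apply/funext => m; rewrite /= (gEnd_right_linear f).1.
have [fD fR] := gEnd_right_linear f; have [hD hR] := gEnd_right_linear h.
apply: (@end_pred_hom (b + a)); last first.
  by move=> c m Dm; rewrite addrA; apply/Df/Dh.
by split=> [m n|m x] /=; rewrite ?hD ?fD ?hR ?fR.
Qed.

Definition end_comp (f h : gEnd) : gEnd := GEnd (end_comp_in f h).

End Endomorphisms.

(* The values of eta f at non homogeneous f and m are determined by additivity. *)
Definition is_eta (G : zmodType) (K : fieldType) (lam : comm_factor G K)
    (s : NS_multiplier lam) (A : gcalg lam) (M : gmod A)
    (eta : gEnd M -> gEnd (twist_mod s M)) : Prop :=
  (forall f h : gEnd M, eta (f + h) = eta f + eta h) /\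
  (forall (g a : G) (f : gEnd M) (m : M),
     gEnd_grading M g f -> gm_gr M a m -> eta f m = s g a *: f m).

(* Main.v *)
Require Import Defs.
From HB Require Import structures.
From mathcomp Require Import all_boot all_order all_algebra.
From mathcomp Require Import mathcomp_extra boolp classical_sets functions.
From mathcomp Require Import cardinality fsbigop.

Set Implicit Arguments.
Unset Strict Implicit.
Unset Printing Implicit Defensive.

Import GRing.Theory.
Local Open Scope ring_scope.

(* The right action of the twisted module satisfies m * x = s(|m|, |x|) m x, so
   the biadditivity of s makes m |-> s(|f|, |m|) f(m) right linear for it.
   Conversely M is the twist by s^-1 of its twisted module, and twisting by s^-1
   inverts the map. *)

Lemma biadditiveV (G : zmodType) (K : fieldType) (c : G -> G -> K) :
  biadditive c -> biadditive (fun x y => (c x y)^-1).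
Proof.
case=> c0 cl cr; split=> [x y|x y z|x y z]; first by rewrite invr_eq0.
  by rewrite cl invfM.
by rewrite cr invfM.
Qed.

Section EndTwist.
Context {G : zmodType} {K : fieldType} {lam : comm_factor G K}.
Context {A : gcalg lam} {M : gmod A}.

(** Multiplication by a scalar [k] is the right action of [k *: ga_one A], so right linearity over
    [A] already contains homogeneity over [K]. *)
Lemma gEnd_linear (f : gEnd M) : linear f.
Proof.
have [fD fR] := gEnd_right_linear f => k m n; rewrite fD.
have actZ (v : M) : ract v (k *: ga_one A) = k *: v.
  by rewrite (bilinZr (ract_bilin M)) ract1.
by rewrite -actZ fR actZ.
Qed.

Lemma gEnd_eval_bilin : bilin (fun (f : gEnd M) (m : M) => f m).
Proof. by split=> [f|m]; [exact: gEnd_linear | move=> k f h]. Qed.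

Lemma gEnd_eqP (f h : gEnd M) :
  (forall a m, gm_gr M a m -> f m = h m) -> f = h.
Proof.
move=> fh; apply: gEndP; apply: (gr_ind (D := gm_gr M)) => [a m|m n mE nE].
  exact: fh.
by rewrite !(gEnd_right_linear _).1 mE nE.
Qed.

(** The factor [c] is arbitrary so that the same map serves for [s] on [M] and for its inverse on
    the twisted module. *)
Definition end_twist (c : G -> G -> K) : gEnd M -> M -> M :=
  twist (gEnd_grading M) (gm_gr M) c (fun f m => f m).

Lemma end_twist_bilin c : bilin (end_twist c).
Proof. exact: twist_bilin gEnd_eval_bilin. Qed.

Lemma end_twistE c g a (f : gEnd M) m :
  gEnd_grading M g f -> gm_gr M a m -> end_twist c f m = c g a *: f m.
Proof. by move=> Df Dm; exact: (twist_hom c gEnd_eval_bilin Df Dm). Qed.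

Lemma end_twist_deg_shift c g (f : gEnd M) :
  gEnd_grading M g f -> deg_shift g (end_twist c f).
Proof.
by move=> Df a m Dm; rewrite (end_twistE _ Df Dm); apply/grZ/Df.
Qed.

(** For [m] of degree [b] and [x] of degree [a], both sides are [f (ract m x)] scaled by
    [c b a * c g b * c g a]: on the left [c g (b + a)] is split, on the right [c (b + g) a]. *)
Lemma end_twist_act c (act : M -> A -> M) g (f : gEnd M) m x :
  biadditive c -> bilin act ->
  (forall a b y n, ga_gr A a y -> gm_gr M b n ->
     act n y = c b a *: ract n y) ->
  gEnd_grading M g f ->
  end_twist c f (act m x) = act (end_twist c f m) x.
Proof.
case=> _ cl cr actb actE Df; have bt := end_twist_bilin c.
have br := ract_bilin M.
elim/(gr_ind (D := ga_gr A)): x => [a x Dx|x x' xE xE']; last first.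
  by rewrite !(bilinDr actb) (bilinDr bt) xE xE'.
elim/(gr_ind (D := gm_gr M)): m => [b m Dm|m m' mE mE']; last first.
  by rewrite (bilinDr bt) !(bilinDl actb) (bilinDr bt) mE mE'.
rewrite (actE _ _ _ _ Dx Dm) (bilinZr bt).
rewrite (end_twistE _ Df (ract_gr Dx Dm)) (end_twistE _ Df Dm).
rewrite (bilinZl actb) (actE _ _ _ _ Dx (Df _ _ Dm)).
rewrite (gEnd_right_linear f).2 !scalerA cr cl; congr (_ *: _).
by rewrite mulrCA !mulrA -!mulrA [c b a * _]mulrC.
Qed.

End EndTwist.

Section Eta.
Context {G : zmodType} {K : fieldType} {lam : comm_factor G K}.
Variables (s : NS_multiplier lam) (A : gcalg lam) (M : gmod A).

Let N := twist_mod s M.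
Let sV (x y : G) : K := (s x y)^-1.

(** [star_ract] is defined from the left action with factor [super lam b a * s a b]. The multiplier
    identity turns this into [lam b a * s b a], and [lam b a] is what exchanges left and right
    actions in [M]. *)
Lemma star_ract_ract a b x (m : M) : ga_gr A a x -> gm_gr M b m ->
  star_ract s m x = s b a *: ract m x.
Proof.
move=> Dx Dm; rewrite (star_ractE _ Dx Dm) (gm_comm Dx Dm) scalerA.
by rewrite -ms_swap mulrC.
Qed.

Lemma end_pred_sum (lam' : comm_factor G K) (B : gcalg lam') (L : gmod B)
    (u v : L -> L) :
  u \in end_pred (M := L) -> v \in end_pred (M := L) ->
  (fun m => u m + v m) \in end_pred (M := L).
Proof.
move=> uE vE; rewrite -[u]scale1r.
exact: (end_pred_closed L).2.
Qed.

(** Membership is additive in [f], which reduces it to homogeneous [f]. Since [M] and [N] have the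
    same carrier, the right action of [N] can be taken as [act] in [end_twist_act]. *)
Lemma eta_in (f : gEnd M) : (end_twist s f : N -> N) \in end_pred (M := N).
Proof.
have bt : bilin (end_twist (M := M) s) := end_twist_bilin s.
elim/(gr_ind (D := gEnd_grading M)): f => [g f Df|f h fE hE]; last first.
  rewrite (_ : end_twist s (f + h) =
    fun m => end_twist s f m + end_twist s h m); last first.
    by apply/funext => m; rewrite (bilinDl bt).
  exact: end_pred_sum.
apply: (@end_pred_hom _ _ _ _ N g); last exact: end_twist_deg_shift Df.
split=> [m n|m x]; first exact: (bilinDr bt f m n).
apply: (end_twist_act (act := star_ract s (M := M)) _ _ _ _ _ Df).
- exact: ms_biadd.
- exact: star_ract_bilin.
- by move=> a b y n; exact: star_ract_ract.
Qed.

Lemma eta_inv_in (f : gEnd N) : (end_twist sV f : M -> M) \in end_pred (M := M).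
Proof.
have [s0 _ _] := ms_biadd s.
have bt : bilin (end_twist (M := N) sV) := end_twist_bilin sV.
elim/(gr_ind (D := gEnd_grading N)): f => [g f Df|f h fE hE]; last first.
  rewrite (_ : end_twist sV (f + h) =
    fun m => end_twist sV f m + end_twist sV h m); last first.
    by apply/funext => m; rewrite (bilinDl bt).
  exact: (end_pred_sum (L := M)).
apply: (@end_pred_hom _ _ _ _ M g);
  last exact: (end_twist_deg_shift (M := N) sV Df).
split=> [m n|m x]; first exact: (bilinDr bt f m n).
(* The roles are exchanged: [N] is the base module, and the action of [M] is its twist by [sV]. *)
apply: (end_twist_act (M := N) (act := @ract _ _ _ _ M) _ _ _ _ _ Df).
- exact: biadditiveV (ms_biadd s).
- exact: (ract_bilin M).
- move=> a b y n Dy Dn.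
  rewrite [X in _ = _ *: X](star_ract_ract Dy Dn : ract (n : N) y = _).
  by rewrite scalerA mulVf // scale1r.
Qed.

Definition eta_map (f : gEnd M) : gEnd N := GEnd (eta_in f).
Definition eta_inv (f : gEnd N) : gEnd M := GEnd (eta_inv_in f).

Lemma eta_mapD f h : eta_map (f + h) = eta_map f + eta_map h.
Proof. by apply: gEndP => m; exact: (bilinDl (end_twist_bilin s) f h m). Qed.

Lemma eta_invD f h : eta_inv (f + h) = eta_inv f + eta_inv h.
Proof.
by apply: gEndP => m; exact: (bilinDl (end_twist_bilin (M := N) sV) f h m).
Qed.

Lemma eta_mapE g a (f : gEnd M) (m : M) :
  gEnd_grading M g f -> gm_gr M a m -> eta_map f m = s g a *: f m.
Proof. exact: end_twistE. Qed.

Lemma eta_invE g a (f : gEnd N) (m : N) :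
  gEnd_grading N g f -> gm_gr N a m -> eta_inv f m = (s g a)^-1 *: f m.
Proof. exact: (end_twistE (M := N)). Qed.

Lemma eta_map_gr g (f : gEnd M) :
  gEnd_grading M g f -> gEnd_grading N g (eta_map f).
Proof. exact: end_twist_deg_shift. Qed.

Lemma eta_inv_gr g (f : gEnd N) :
  gEnd_grading N g f -> gEnd_grading M g (eta_inv f).
Proof. exact: (end_twist_deg_shift (M := N)). Qed.

Lemma eta_mapK : cancel eta_map eta_inv.
Proof.
have [s0 _ _] := ms_biadd s.
apply: (gr_ind (D := gEnd_grading M)) => [g f Df|f h fE hE]; last first.
  by rewrite eta_mapD eta_invD fE hE.
(* [eta_map f] keeps the degree [g], so the second twist contributes exactly the inverse of
   [s g a]. *)
apply: gEnd_eqP => a m Dm; rewrite (eta_invE (eta_map_gr Df) Dm).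
by rewrite (eta_mapE Df Dm) scalerA mulVf // scale1r.
Qed.

Lemma eta_invK : cancel eta_inv eta_map.
Proof.
have [s0 _ _] := ms_biadd s.
apply: (gr_ind (D := gEnd_grading N)) => [g f Df|f h fE hE]; last first.
  by rewrite eta_invD eta_mapD fE hE.
apply: gEnd_eqP => a m Dm; rewrite (eta_mapE (eta_inv_gr Df) Dm).
by rewrite (eta_invE Df Dm) scalerA mulfV // scale1r.
Qed.

(** Acting by an element of degree 0 preserves the degree of [f], hence the factor [s g a], and the
    twisted action of such an element is the original one because [s 0 _ = 1]. *)
Lemma eta_map_act x (f : gEnd M) : ga_gr A 0 x ->
  eta_map (end_act x f) = end_act (x : twist_alg s A) (eta_map f).
Proof.
move=> Dx.
elim/(gr_ind (D := gEnd_grading M)): f => [g f Df|f h fE hE]; last first.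
  by rewrite (bilinDr (end_act_bilin M)) !eta_mapD fE hE
             (bilinDr (end_act_bilin N)).
have Dxf : gEnd_grading M g (end_act x f).
  by move=> b n Dn; rewrite -[_ + g]add0r; apply: lact_gr => //; exact: Df.
apply: gEnd_eqP => a m Dm; rewrite (eta_mapE Dxf Dm).
rewrite [RHS](star_lactE s Dx (eta_map_gr Df Dm)) (eta_mapE Df Dm).
rewrite (biadd0l _ (ms_biadd s)) scale1r.
by rewrite (bilinZr (lact_bilin M)).
Qed.

(** On degree [a] the composite receives [s (g + h) a = s g a * s h a]. Applied in turn, [k] gives
    [s h a] and [f], now acting in degree [a + h], gives [s g a * s g h]; the surplus [s g h] is
    what the inverse cancels. *)
Lemma eta_map_comp g h (f k : gEnd M) :
  gEnd_grading M g f -> gEnd_grading M h k ->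
  eta_map (end_comp f k) = (s g h)^-1 *: end_comp (eta_map f) (eta_map k).
Proof.
have [s0 sl sr] := ms_biadd s => Df Dk.
have Dfk : gEnd_grading M (g + h) (end_comp f k).
  by move=> b n Dn; rewrite [g + h]addrC addrA; apply/Df/Dk.
apply: gEnd_eqP => a m Dm; rewrite (eta_mapE Dfk Dm).
rewrite [RHS](_ : _ = (s g h)^-1 *: eta_map f (eta_map k m)) //.
rewrite (eta_mapE Df (eta_map_gr Dk Dm)) (eta_mapE Dk Dm).
rewrite [f (_ *: _)](bilinZr gEnd_eval_bilin) !scalerA sl sr; congr (_ *: _).
by rewrite [s g a * s g h]mulrC mulKf.
Qed.

Lemma eta_map_is_eta : is_eta eta_map.
Proof. by split; [exact: eta_mapD | move=> g a f m; exact: eta_mapE]. Qed.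

(** Homogeneous endomorphisms generate [gEnd M] additively, and an endomorphism is determined by its
    values on homogeneous vectors. *)
Lemma is_eta_unique e e' : is_eta (s := s) (M := M) e -> is_eta e' -> e = e'.
Proof.
case=> eD eE [eD' eE']; apply/funext.
apply: (gr_ind (D := gEnd_grading M)) => [g f Df|f h fE hE]; last first.
  by rewrite eD eD' fE hE.
by apply: gEnd_eqP => a m Dm; rewrite (eE g a) // (eE' g a).
Qed.

End Eta.

Theorem theorem1 (K : fieldType) (charK : [pchar K] =i pred0)
    (G : zmodType) (fgG : finitely_generated G)
    (lam : comm_factor G K) (s : NS_multiplier lam)
    (A : gcalg lam) (M : gmod A) :
  exists eta : gEnd M -> gEnd (twist_mod s M),
    [/\ unique (@is_eta G K lam s A M) eta,
        bijective eta,
        (forall (x : A) (f : gEnd M), ga_gr A 0 x ->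
           eta (end_act x f) = end_act (x : twist_alg s A) (eta f))
      & forall (g h : G) (f k : gEnd M),
          gEnd_grading M g f -> gEnd_grading M h k ->
          eta (end_comp f k) = (s g h)^-1 *: end_comp (eta f) (eta k)].
Proof.
exists (eta_map s (M := M)); split.
- by split=> [|e]; [exact: eta_map_is_eta | apply/is_eta_unique/eta_map_is_eta].
- by exists (eta_inv (s := s) (M := M)); [exact: eta_mapK | exact: eta_invK].
- by move=> x f; exact: eta_map_act.
- exact: eta_map_comp.
Qed.
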